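(* Let $N\ge 1$ and let $f:[0,1]\to\mathbb{R}$ be continuous and strictly increasing, with $f\in C^1(0,1)$ and such that $1/f'$ is positive and concave on $(0,1)$. Define $F:T\Delta_N^\circ\to\mathbb{R}_{\ge 0}$ by $F(v)=\max_i f'(p_i)v_i$ for $v\in T_P\Delta_N^\circ$. Then for every bistochastic $(N+1)\times(N+1)$ matrix $S$, $$F(Sv)\le F(v)\qquad\text{for all } P\in\Delta_N^\circ,\ v\in T_P\Delta_N^\circ,$$ where $Sv$ is regarded as an element of $T_{SP}\Delta_N^\circ$; and, as a consequence, $$D_f(SP,SQ)\le D_f(P,Q)\qquad\text{for all } P,Q\in\Delta_N.$$
   Context: $\Delta_N=\{P=(p_0,\dots,p_N)\in[0,1]^{N+1} : \sum_i p_i=1\}$ is the $N$-dimensional probability simplex in $\mathbb{R}^{N+1}$, and $\Delta_N^\circ$ is its (relative) interior, i.e. the points with all $p_i>0$. For a continuous strictly increasing $f:[0,1]\to\mathbb{R}$ one sets $D_f(P,Q)=\max_{0\le i\le N}\big(f(q_i)-f(p_i)\big)$. (Without loss of generality $f$ may be rescaled affinely so that $f(0)=0$, $f(1)=1$.) For $P\in\Delta_N^\circ$ the tangent space is identified with $T_P\Delta_N^\circ=\{v=(v_0,\dots,v_N)\in\mathbb{R}^{N+1} : \sum_i v_i=0\}$. A square matrix $S=(S_{ij})_{0\le i,j\le N}$ is bistochastic if $S_{ij}\ge 0$ for all $i,j$, $\sum_i S_{ij}=1$ for every $j$, and $\sum_j S_{ij}=1$ for every $i$. It acts on vectors of $\mathbb{R}^{N+1}$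 by matrix multiplication. *)

(* Defs.v *)
From HB Require Import structures.
From mathcomp Require Import all_boot all_order all_algebra.
From mathcomp Require Import all_classical all_reals all_analysis.

Set Implicit Arguments.
Unset Strict Implicit.
Unset Printing Implicit Defensive.

Import Order.TTheory GRing.Theory Num.Theory.
Import numFieldNormedType.Exports.

Local Open Scope classical_set_scope.
Local Open Scope ring_scope.

Section Defs.
Context {R : realType}.

Definition concave_function (D : set R) (g : R -> R) : Prop :=
  @convex_function R R^o D (fun x => - g x).

Definition simplex (N : nat) : set 'cV[R]_N.+1 :=
  [set P | (forall i, P i ord0 \in `[0, 1]%R) /\ \sum_i P i ord0 = 1].

Definition open_simplex (N : nat) : set 'cV[R]_N.+1 :=
  [set P | simplex P /\ forall i, 0 < P i ord0].

(* The tangent space at any point of [open_simplex N]; as a subspace of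
   R^(N+1) it does not depend on the base point. *)
Definition tangent_space (N : nat) : set 'cV[R]_N.+1 :=
  [set v | \sum_i v i ord0 = 0].

Definition bistochastic (n : nat) (S : 'M[R]_n) : Prop :=
  [/\ forall i j, 0 <= S i j,
      forall j, \sum_i S i j = 1 &
      forall i, \sum_j S i j = 1].

(* Iterating from the value at [ord0], itself one of the terms, rather than
   from 0 makes this the maximum of the g i whatever their signs. *)
Definition max_ord (N : nat) (g : 'I_N.+1 -> R) : R :=
  \big[Num.max/g ord0]_(i < N.+1) g i.

Definition divergence (f : R -> R) (N : nat) (P Q : 'cV[R]_N.+1) : R :=
  max_ord (fun i => f (Q i ord0) - f (P i ord0)).

Definition finsler (f : R -> R) (N : nat) (P v : 'cV[R]_N.+1) : R :=
  max_ord (fun i => derive1 f (P i ord0) * v i ord0).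

End Defs.

(* Main.v *)
Require Import Defs.
From HB Require Import structures.
From mathcomp Require Import all_boot all_order all_algebra.
From mathcomp Require Import all_classical all_reals all_analysis.
From mathcomp Require Import lra.

(* Put g = 1/f', which is positive and concave.  Since F(v) <= c says
   v_i <= c g(p_i) for all i, Jensen's inequality gives
   (Sv)_i <= c sum_j S_ij g(p_j) <= c g((SP)_i), which is the contraction of F.
   For D_f, join p_j to q_j by the path along which f is affine.  Its velocity
   is at most c g, with c = D_f(P, Q), so the same computation applied to the
   S-averaged path bounds the derivative of f along it by c, and the mean value
   theorem concludes.  Points on the boundary are reached as limits, contracting
   towards an interior point. *)

Set Implicit Arguments.
Unset Strict Implicit.
Unset Printing Implicit Defensive.

Import Order.TTheory GRing.Theory Num.Theory.
Import numFieldNormedType.Exports.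

Local Open Scope classical_set_scope.
Local Open Scope ring_scope.

(** * Jensen's inequality for finite weighted means *)

Lemma concave_function_sum (R : realType) (D : set R) (g : R -> R) :
  @convex_set R R^o D -> concave_function D g ->
  forall n (w x : 'I_n -> R), (forall j, 0 <= w j) -> \sum_j w j = 1 ->
  (forall j, D (x j)) ->
  D (\sum_j w j * x j) /\ \sum_j w j * g (x j) <= g (\sum_j w j * x j).
Proof.
move=> convD concg; elim=> [|n IH] w x w0 w1 Dx.
  by move: w1; rewrite big_ord0 => /esym/eqP; rewrite oner_eq0.
have w1' : \sum_(j < n) w (lift ord0 j) = 1 - w ord0.
  by rewrite -w1 big_ord_recl addrAC subrr add0r.
have W0 : 0 <= 1 - w ord0 by rewrite -w1' sumr_ge0.
(* The induction splits off the first point and renormalises the other weights by their total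
   [1 - w ord0]. When that total vanishes, so does each of them, and only the first point
   remains. *)
have [W|W] := eqVneq (1 - w ord0) 0.
  have w'0 j : w (lift ord0 j) = 0.
    move: w1'; rewrite W => /eqP; rewrite psumr_eq0// => /allP.
    by move=> /(_ j (mem_index_enum _)) /eqP.
  rewrite !big_ord_recl !big1 => [|j _|j _]; rewrite ?w'0 ?mul0r//.
  by move/eqP: W; rewrite subr_eq0 => /eqP <-; rewrite !addr0 !mul1r.
have sumW (y : 'I_n -> R) : \sum_j w (lift ord0 j) * y j =
    (1 - w ord0) * \sum_j w (lift ord0 j) / (1 - w ord0) * y j.
  by rewrite mulr_sumr; apply: eq_bigr => j _; rewrite mulrCA mulrA divfK// mulrC.
have [||j|Dy gy] := IH (fun j => w (lift ord0 j) / (1 - w ord0))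
    (fun j => x (lift ord0 j)).
- by move=> j; rewrite divr_ge0.
- by rewrite -mulr_suml w1' divff.
- exact: Dx.
have w01 : 0 <= w ord0 <= 1 by rewrite w0 -subr_ge0.
pose t : {i01 R} := Itv01 (w0 ord0) (proj2 (andP w01)).
rewrite !big_ord_recl !sumW; split.
  by have := convD (x ord0) _ t (mem_set (Dx ord0)) (mem_set Dy); rewrite inE.
have := concg t (x ord0) _ (mem_set (Dx ord0)) (mem_set Dy).
rewrite -convN lerN2 convRE.
by apply: le_trans; rewrite lerD2l ler_wpM2l.
Qed.

Lemma convex_set_itvoo (R : realType) (a b : R) :
  @convex_set R R^o `]a, b[%classic.
Proof.
move=> x y t; rewrite !inE /= !in_itv/= => /andP[ax xb] /andP[ay yb].
(* A convex combination of the distances to an endpoint is the distance of the combined point to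
   that endpoint. *)
have ta : 0 < conv t (x - a : R^o) (y - a : R^o) by rewrite convR_gt0 ?subr_gt0.
have tb : 0 < conv t (b - x : R^o) (b - y : R^o) by rewrite convR_gt0 ?subr_gt0.
move: ta tb; rewrite !convRE /conv/= /unstable.onem /GRing.scale/= => ta tb.
by apply/andP; split; lra.
Qed.

(** The shared core of both contractions: [v] is a tangent vector in one case and the velocities of
    the paths in the other. The sign of [c] lets Jensen's inequality be multiplied by it. *)
Lemma sum_mul_le_concave (R : realType) (D : set R) (g : R -> R) (c : R)
    (n : nat) (w x v : 'I_n -> R) :
  @convex_set R R^o D -> concave_function D g -> 0 <= c ->
  (forall j, 0 <= w j) -> \sum_j w j = 1 -> (forall j, D (x j)) ->
  (forall j, v j <= c * g (x j)) ->
  \sum_j w j * v j <= c * g (\sum_j w j * x j).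
Proof.
move=> convD concg c0 w0 w1 Dx vc.
have [_ gx] := concave_function_sum convD concg w0 w1 Dx.
apply: le_trans (ler_wpM2l c0 gx); rewrite mulr_sumr; apply: ler_sum => j _.
by rewrite mulrCA ler_wpM2l.
Qed.

(** * Paths along which [f] is affine *)

Lemma increasing_itvoo_inverse (R : realType) (a b : R) (f : R -> R) :
  {in `]a, b[ &, forall x y : R, x < y -> f x < f y} ->
  {in `]a, b[, forall x : R, derivable f x 1} ->
  {in `]a, b[, forall x : R, derive1 f x != 0} ->
  exists finv : R -> R,
    (forall p q y, p \in `]a, b[ -> q \in `]a, b[ ->
       Num.min (f p) (f q) <= y <= Num.max (f p) (f q) ->
       (finv y \in `]a, b[) /\
       is_derive y 1 finv (derive1 f (finv y))^-1) /\
    {in `]a, b[, cancel f finv}.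
Proof.
move=> f_incr f_diff f'_neq0.
(* The default 0 is taken only off the image of the open interval under [f]. *)
pose finv y := xget 0 [set x | (x \in `]a, b[) /\ f x = y].
have finvK : {in `]a, b[, cancel f finv}.
  move=> x xab; rewrite /finv; case: xgetP => [z _ [zab fzx]|/(_ x)[]//].
  by have [zx|xz|//] := ltgtP z x;
    [have := f_incr _ _ zab xab zx|have := f_incr _ _ xab zab xz];
    rewrite fzx ltxx.
exists finv; split=> // p q y.
wlog pq : p q / p <= q.
  by move=> H pab qab; case/orP: (le_total p q) => ? ?;
    [apply: (H p q)|apply: (H q p); rewrite // minC maxC].
move=> pab qab fpq.
have pqab x : x \in `[p, q] -> x \in `]a, b[.
  move: pab qab; rewrite !in_itv/= => /andP[ap _] /andP[_ qb] /andP[px xq].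
  by rewrite (lt_le_trans ap px) (le_lt_trans xq qb).
(* A value between [f p] and [f q] is attained on [[p, q]], so the image of [f] needs no description
   by limits at [a] and [b]. *)
have /(IVT pq) : {within `[p, q], continuous f}.
  by apply: derivable_within_continuous => x /pqab; exact: f_diff.
move=> /(_ _ fpq)[x /pqab xab <-{y fpq}]; rewrite finvK//; split=> //.
have nearab := near_in_itvoo xab.
apply: is_derive_inverse.
- by near=> z; apply: finvK; near: z.
- near=> z; apply/differentiable_continuous/derivable1_diffP/f_diff; near: z.
  exact: nearab.
- by rewrite derive1E; apply/derivableP/f_diff.
- exact: f'_neq0.
Unshelve. all: by end_near. Qed.

Lemma increment_le (R : realType) (a b c : R) (h dh : R -> R) :
  a <= b -> (forall x : R, x \in `[a, b] -> is_derive x 1 h (dh x)) ->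
  (forall x, x \in `[a, b] -> dh x <= c) ->
  h b - h a <= c * (b - a).
Proof.
move=> ab dhP dhc; have H := MVT_segment (f := h) (df := dh) ab.
have /H{}H : forall x, x \in `]a, b[ -> is_derive x 1 h (dh x).
  move=> x xab; apply: dhP.
  by move: xab; rewrite !in_itv/= => /andP[/ltW -> /ltW ->].
have /H{H}[x xab ->] : {within `[a, b], continuous h}.
  by apply: derivable_within_continuous => x /dhP[].
by rewrite ler_wpM2r ?subr_ge0// dhc.
Qed.

Lemma increment_mean_le (R : realType) (a b : R) (f : R -> R) :
  {in `]a, b[ &, forall x y : R, x < y -> f x < f y} ->
  {in `]a, b[, forall x : R, derivable f x 1} ->
  {in `]a, b[, forall x : R, 0 < (derive1 f x)^-1} ->
  concave_function `]a, b[%classic (fun x => (derive1 f x)^-1) ->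
  forall (c : R) (n : nat) (w p q : 'I_n -> R), 0 <= c ->
  (forall j, 0 <= w j) -> \sum_j w j = 1 ->
  (forall j, p j \in `]a, b[) -> (forall j, q j \in `]a, b[) ->
  (forall j, f (q j) - f (p j) <= c) ->
  f (\sum_j w j * q j) - f (\sum_j w j * p j) <= c.
Proof.
move=> f_incr f_diff f'_gt0 f'_conc c n w p q c0 w0 w1 pab qab fpq.
have f'_neq0 : {in `]a, b[, forall x, derive1 f x != 0}.
  by move=> x /f'_gt0; rewrite invr_gt0 => /lt0r_neq0.
have [finv [dfinv finvK]] := increasing_itvoo_inverse f_incr f_diff f'_neq0.
(* [gam j] runs from [p j] to [q j], and [f] has constant slope [d j] along it. For [s] in [0, 1]
   the argument of [finv] lies between [f (p j)] and [f (q j)], where [finv] is differentiable. *)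
pose d j := f (q j) - f (p j).
pose gam j s := finv (f (p j) + d j * s).
have gamP j (s : R) : s \in `[0, 1] -> (gam j s \in `]a, b[) /\
    is_derive s 1 (gam j) ((derive1 f (gam j s))^-1 * d j).
  rewrite in_itv/= => /andP[s0 s1].
  have [|gab dgam] := dfinv _ _ (f (p j) + d j * s) (pab j) (qab j).
    have [fpqj|fpqj] := leP (f (p j)) (f (q j)); rewrite /d; nra.
  split=> //; apply: is_derive1_comp.
  have -> : (fun s => f (p j) + d j * s) = cst (f (p j)) + d j \*: id by [].
  by apply: is_derive_eq; rewrite add0r /GRing.scale/= mulr1.
have convab := @convex_set_itvoo R a b.
pose Gam (s : R) := \sum_j w j * gam j s.
have Gamab (s : R) : s \in `[0, 1] -> Gam s \in `]a, b[.
  move=> s01; apply: (concave_function_sum convab f'_conc w0 w1 _).1 => j.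
  exact: (gamP j s s01).1.
pose dGam (s : R) := \sum_j w j * ((derive1 f (gam j s))^-1 * d j).
have dGamP (s : R) : s \in `[0, 1] -> is_derive s 1 Gam (dGam s).
  move=> s01.
  have -> : Gam = \sum_j w j \*: gam j.
    by apply/funext => u; rewrite fct_sumE.
  by apply: is_derive_sum => j; apply: is_deriveZ; have [] := gamP j s s01.
have dfGam (s : R) : s \in `[0, 1] ->
    is_derive s 1 (f \o Gam) (derive1 f (Gam s) * dGam s).
  move=> s01; have Gs := Gamab s s01; have ? := dGamP s s01.
  by apply: is_derive1_comp; rewrite derive1E; apply/derivableP/f_diff.
have gam0 j : gam j 0 = p j by rewrite /gam mulr0 addr0 finvK.
have gam1 j : gam j 1 = q j by rewrite /gam mulr1 addrC subrK finvK.
have <- : Gam 1 = \sum_j w j * q j by apply: eq_bigr => j _; rewrite gam1.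
have <- : Gam 0 = \sum_j w j * p j by apply: eq_bigr => j _; rewrite gam0.
rewrite -[leRHS]mulr1 -[X in _ * X]subr0.
apply: (increment_le ler01 dfGam) => s s01.
have := f'_gt0 _ (Gamab s s01); rewrite invr_gt0 => f'G.
(* Dividing by f' at [Gam s] leaves a bound on the averaged velocity by [c] times 1/f' at the
   averaged point. *)
rewrite -ler_pdivlMl// mulrC.
apply: (sum_mul_le_concave convab f'_conc c0 w0 w1).
  by move=> j; exact: (gamP j s s01).1.
by move=> j; rewrite mulrC ler_wpM2r ?fpq// ltW// f'_gt0// (gamP j s s01).1.
Qed.

(** * Passage to the closed interval *)

Lemma cvg_contract_within (R : realType) (a b x z : R) (f : R -> R) :
  {within `[a, b], continuous f} -> x \in `[a, b] -> z \in `[a, b] ->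
  f (x + t * (z - x)) @[t --> 0^'+] --> f x.
Proof.
move=> /subspace_continuousP/(_ x) + xab zab => /(_ xab) fx.
apply: (cvg_comp (fun t => x + t * (z - x)) f _ fx) => A [e /= e0 Ae].
(* The added 1 keeps the denominator positive when [z] equals [x]. *)
have d0 : 0 < e / (`|z - x| + 1) by rewrite divr_gt0// ltr_wpDl.
near=> t; have t0 : 0 < t by [].
have t1 : t < 1 by near: t; exact: nbhs_right_lt.
apply: Ae; last first.
  by move: xab zab; rewrite /= !in_itv/= => /andP[ax xb] /andP[az zb]; nra.
have : t < e / (`|z - x| + 1) by near: t; exact: nbhs_right_lt.
rewrite ltr_pdivlMr ?ltr_wpDl// => te.
rewrite /= opprD addrA subrr sub0r normrN normrM (gtr0_norm t0).
by apply: le_lt_trans te; rewrite ler_wpM2l ?lerDl// ltW.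
Unshelve. all: by end_near. Qed.

Lemma increment_mean_le_closed (R : realType) (a b : R) (f : R -> R) :
  a < b -> {within `[a, b], continuous f} ->
  {in `]a, b[ &, forall x y : R, x < y -> f x < f y} ->
  {in `]a, b[, forall x : R, derivable f x 1} ->
  {in `]a, b[, forall x : R, 0 < (derive1 f x)^-1} ->
  concave_function `]a, b[%classic (fun x => (derive1 f x)^-1) ->
  forall (c : R) (n : nat) (w p q : 'I_n -> R), 0 <= c ->
  (forall j, 0 <= w j) -> \sum_j w j = 1 ->
  (forall j, p j \in `[a, b]) -> (forall j, q j \in `[a, b]) ->
  (forall j, f (q j) - f (p j) <= c) ->
  f (\sum_j w j * q j) - f (\sum_j w j * p j) <= c.
Proof.
move=> ab f_cont f_incr f_diff f'_gt0 f'_conc c n w p q c0 w0 w1 pab qab fpq.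
(* Pulling towards the midpoint moves the closed interval into the open one and, being affine,
   commutes with weighted means. *)
pose z := (a + b) / 2; pose pull (t x : R) := x + t * (z - x).
have zab : z \in `[a, b] by rewrite in_itv/= /z; lra.
have pull_itv (t x : R) : 0 < t -> t < 1 -> x \in `[a, b] -> pull t x \in `]a, b[.
  by rewrite !in_itv/= /pull /z => t0 t1 /andP[ax xb]; nra.
have pull_sum (t : R) (x : 'I_n -> R) :
    \sum_j w j * pull t (x j) = pull t (\sum_j w j * x j).
  under eq_bigr do rewrite mulrDr mulrCA mulrBr.
  by rewrite big_split /= -mulr_sumr sumrB -mulr_suml w1 mul1r.
have mean_itv (x : 'I_n -> R) : (forall j, x j \in `[a, b]) ->
    \sum_j w j * x j \in `[a, b].
  move=> xab; rewrite in_itv/= -[a]mul1r -[b in _ && (_ <= b)]mul1r -w1 !mulr_suml.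
  by apply/andP; split; apply: ler_sum => j _; apply: ler_wpM2l => //;
    have := xab j; rewrite in_itv/= => /andP[].
have cvg_pull x y : x \in `[a, b] -> y \in `[a, b] ->
    f (pull t y) - f (pull t x) @[t --> 0^'+] --> f y - f x.
  by move=> xab yab; apply: cvgB; exact: cvg_contract_within f_cont _ zab.
(* The bound [c] may fail for the pulled points; with slack [e] it holds for all small [t],
   simultaneously for the finitely many [j]. *)
apply/ler_addgt0Pr => e e0.
have {}fpq : \forall t \near 0^'+, forall j : 'I_n,
    f (pull t (q j)) - f (pull t (p j)) <= c + e.
  apply: filter_forall => j; apply: (cvgr_le _ (cvg_pull _ _ (pab j) (qab j))).
  by rewrite ltr_pwDr.
apply: (cvgr_to_le (cvg_pull _ _ (mean_itv p pab) (mean_itv q qab))).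
near=> t.
have t0 : 0 < t by [].
have t1 : t < 1 by near: t; exact: nbhs_right_lt.
rewrite -!pull_sum.
apply: (increment_mean_le f_incr f_diff f'_gt0 f'_conc) => //.
- by rewrite addr_ge0// ltW.
- by move=> j; apply: pull_itv.
- by move=> j; apply: pull_itv.
- by near: t.
Unshelve. all: by end_near. Qed.

(** * Maxima, the simplex and bistochastic matrices *)

Lemma le_max_ord (R : realType) (N : nat) (g : 'I_N.+1 -> R) i : g i <= max_ord g.
Proof. exact: le_bigmax. Qed.

Lemma max_ord_le (R : realType) (N : nat) (g : 'I_N.+1 -> R) (c : R) :
  (forall i, g i <= c) -> max_ord g <= c.
Proof. by move=> gc; apply: bigmax_le. Qed.

(** Applied to a tangent vector and to [Q - P], this makes F and D_f nonnegative, as their role as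
    the constant [c] demands. *)
Lemma sum0_exists_ge0 (R : realType) (N : nat) (v : 'I_N.+1 -> R) :
  \sum_i v i = 0 -> exists i, 0 <= v i.
Proof.
move=> v0; apply: contrapT => /forallNP vlt0.
have /psumr_eq0P : forall i, true -> 0 <= - v i.
  by move=> i _; rewrite oppr_ge0; have /negP := vlt0 i; rewrite -ltNge => /ltW.
rewrite sumrN v0 oppr0 => /(_ erefl ord0 isT)/eqP; rewrite oppr_eq0 => /eqP v00.
by apply: (vlt0 ord0); rewrite v00.
Qed.

(** Unit column sums preserve the total; unit row sums, by contrast, make each entry of [S *m v] a
    weighted mean. *)
Lemma bistochastic_sum (R : realType) (n : nat) (S : 'M[R]_n) (v : 'cV[R]_n) :
  bistochastic S -> \sum_i (S *m v) i ord0 = \sum_i v i ord0.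
Proof.
move=> [_ S1 _]; under eq_bigr do rewrite mxE.
by rewrite exchange_big /=; apply: eq_bigr => j _; rewrite -mulr_suml S1 mul1r.
Qed.

Lemma simplexP (R : realType) (N : nat) (P : 'cV[R]_N.+1) :
  (forall i, 0 <= P i ord0) -> \sum_i P i ord0 = 1 -> simplex P.
Proof.
move=> P0 P1; split=> // i; rewrite in_itv/= P0/= -P1 (bigD1 i)//= lerDl.
exact: sumr_ge0.
Qed.

Lemma bistochastic_simplex (R : realType) (N : nat) (S : 'M[R]_N.+1) (P : 'cV[R]_N.+1) :
  bistochastic S -> simplex P -> simplex (S *m P).
Proof.
move=> bS [P0 P1]; apply: simplexP; last by rewrite bistochastic_sum.
move=> i; rewrite mxE sumr_ge0// => j _; have [S0 _ _] := bS.
by rewrite mulr_ge0//; have := P0 j; rewrite in_itv/= => /andP[].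
Qed.

Lemma open_simplex_itv (R : realType) (N : nat) (P : 'cV[R]_N.+1) :
  (1 <= N)%N -> open_simplex P -> forall i, P i ord0 \in `]0, 1[.
Proof.
case: N P => // N P _ [[_ P1] P0] i; rewrite in_itv/= P0/= -P1 (bigD1 i)//= ltrDl.
(* [lift i ord0] is an index other than [i]; its positive entry keeps [P i ord0] strictly below
   1. *)
rewrite (bigD1 (lift i ord0))/= ?neq_lift// 1?eq_sym ?neq_lift//.
by rewrite ltr_pwDl// sumr_ge0// => j _; exact/ltW/P0.
Qed.

Lemma finsler_ge0 (R : realType) (N : nat) (f : R -> R) (P v : 'cV[R]_N.+1) :
  (forall i, 0 <= derive1 f (P i ord0)) -> tangent_space v -> 0 <= finsler f P v.
Proof.
move=> f'0 /sum0_exists_ge0[i vi0].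
by apply: le_trans (le_max_ord _ i); rewrite mulr_ge0.
Qed.

Lemma divergence_ge0 (R : realType) (N : nat) (f : R -> R) (P Q : 'cV[R]_N.+1) :
  {in `[0, 1] &, forall x y : R, x < y -> f x < f y} ->
  simplex P -> simplex Q -> 0 <= divergence f P Q.
Proof.
move=> f_incr [P01 P1] [Q01 Q1].
have [i PQ] : exists i, 0 <= Q i ord0 - P i ord0.
  by apply: sum0_exists_ge0; rewrite sumrB P1 Q1 subrr.
apply: le_trans (le_max_ord _ i); rewrite subr_ge0.
move: PQ; rewrite subr_ge0 le_eqVlt => /predU1P[->//|PQ].
exact/ltW/f_incr.
Qed.

(** * The two contractions *)

Theorem theorem4p1 (R : realType) (N : nat) (hN : (1 <= N)%N) (f : R -> R)
    (f_cont : {within `[0, 1]%classic, continuous f})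
    (f_incr : {in `[0, 1] &, forall x y : R, x < y -> f x < f y})
    (f_diff : {in `]0, 1[, forall x : R, derivable f x 1})
    (f_C1 : {in `]0, 1[, continuous (derive1 f)})
    (invf'_gt0 : {in `]0, 1[, forall x : R, 0 < (derive1 f x)^-1})
    (invf'_concave :
       concave_function `]0, 1[%classic (fun x => (derive1 f x)^-1)) :
  [/\ forall P v : 'cV[R]_N.+1, open_simplex P -> tangent_space v ->
        0 <= finsler f P v,
      forall S : 'M[R]_N.+1, bistochastic S ->
        forall P v : 'cV[R]_N.+1, open_simplex P -> tangent_space v ->
        [/\ open_simplex (S *m P), tangent_space (S *m v) &
            finsler f (S *m P) (S *m v) <= finsler f P v]
    & forall S : 'M[R]_N.+1, bistochastic S ->
        forall P Q : 'cV[R]_N.+1, simplex P -> simplex Q ->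
        [/\ simplex (S *m P), simplex (S *m Q) &
            divergence f (S *m P) (S *m Q) <= divergence f P Q]].
Proof.
have itvP := @open_simplex_itv R N; have convex01 := @convex_set_itvoo R 0 1.
have f'_gt0 : {in `]0, 1[, forall x : R, 0 < derive1 f x}.
  by move=> x /invf'_gt0; rewrite invr_gt0.
have F_ge0 (P v : 'cV[R]_N.+1) : open_simplex P -> tangent_space v ->
    0 <= finsler f P v.
  by move=> oP; apply: finsler_ge0 => i; apply/ltW/f'_gt0/itvP.
split=> // S bS; have [S0 _ S1] := bS.
- move=> P v oP v0.
  have SP01 i : (S *m P) i ord0 \in `]0, 1[.
    rewrite mxE.
    exact: (concave_function_sum convex01 invf'_concave (S0 i) (S1 i)
      (itvP P hN oP)).1.
  split.
  + split; first exact: bistochastic_simplex oP.1.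
    by move=> i; have := SP01 i; rewrite in_itv/= => /andP[].
  + by rewrite /tangent_space /= bistochastic_sum.
  (* Dividing by f' turns both the goal and the bounds by the maximum F(v) into the form v_j <= F(v)
     / f'(p_j), with row [i] of [S] as weights. *)
  + apply: max_ord_le => i; rewrite mulrC -ler_pdivlMr ?f'_gt0//.
    rewrite !mxE in SP01 *.
    apply: (sum_mul_le_concave convex01 invf'_concave (F_ge0 P v oP v0) (S0 i)
      (S1 i)) => j; first exact: itvP.
    rewrite ler_pdivlMr ?f'_gt0 ?itvP// mulrC.
    exact: (le_max_ord (fun k => derive1 f (P k ord0) * v k ord0)).
- move=> P Q sP sQ; split; [exact: bistochastic_simplex..|].
  apply: max_ord_le => i; rewrite !mxE.
  have f_incr' : {in `]0, 1[ &, forall x y : R, x < y -> f x < f y}.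
    move=> x y; rewrite !in_itv/= => /andP[/ltW x0 /ltW x1] /andP[/ltW y0 /ltW y1].
    by apply: f_incr; rewrite in_itv/= ?x0 ?y0.
  (* Here [c] is D_f(P, Q), and the weights are again row [i] of [S]. *)
  apply: (increment_mean_le_closed ltr01 f_cont f_incr' f_diff invf'_gt0
    invf'_concave (divergence_ge0 f_incr sP sQ) (S0 i) (S1 i) sP.1 sQ.1) => j.
  exact: (le_max_ord (fun k => f (Q k ord0) - f (P k ord0))).
Qed.
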